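(* Let $n\ge 4$ be even and $k$ an integer. If $\varphi(n)\nmid k$ and $\varphi(n)\nmid k+n-1$, then $\mathrm{CP}(k,n)$ is Hamiltonian.
   Context: For an integer $k$ and a positive integer $n$, $\mathrm{CP}(k,n)$ is the simple graph with vertex set $\{k,k+1,\ldots,k+n-1\}$ in which two distinct vertices $a,b$ are adjacent if and only if $\gcd(a,b)=1$ (with $\gcd(a,0)=|a|$). For a positive integer $n$, $\varphi(n)$ denotes the product of all odd primes less than $n$. A graph is Hamiltonian if it contains a cycle through every vertex exactly once. *)

(* Defs.v *)
From HB Require Import structures.
From mathcomp Require Import all_boot all_order all_algebra.
From mathcomp Require Import zify.

Set Implicit Arguments.
Unset Strict Implicit.
Unset Printing Implicit Defensive.

Import Order.TTheory GRing.Theory Num.Theory.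
Local Open Scope ring_scope.

Record sgraph := SGraph {
  vertex :> finType;
  adj : rel vertex;
  adj_sym : symmetric adj;
  adj_irrefl : irreflexive adj }.

(* The bound 2 < size c is needed because ucycle also accepts [::], and [:: x; y]
   with x, y adjacent, neither of which is a cycle of a simple graph. *)
Definition hamiltonian (G : sgraph) : Prop :=
  exists c : seq G, [/\ (2 < size c)%N, ucycle (@adj G) c & forall x : G, x \in c].

Definition CP_vertices (k : int) (n : nat) : seq int :=
  [seq k + i%:Z | i <- iota 0 n].

Lemma mem_CP_vertices (k : int) (n : nat) (x : int) :
  (x \in CP_vertices k n) = (k <= x < k + n%:Z).
Proof.
apply/mapP/idP => [[i]|xP]; first by rewrite mem_iota => ? ->; lia.
by exists `|x - k|%N; rewrite ?mem_iota; lia.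
Qed.

(* gcdz is the nonnegative gcd on int, with gcdz a 0 = |a|. *)
Definition CP_adj (k : int) (n : nat) : rel (seq_sub (CP_vertices k n)) :=
  [rel a b | (a != b) && (gcdz (val a) (val b) == 1)].

Lemma CP_adj_sym (k : int) (n : nat) : symmetric (@CP_adj k n).
Proof. by move=> a b; rewrite /CP_adj /= eq_sym gcdzC. Qed.

Lemma CP_adj_irrefl (k : int) (n : nat) : irreflexive (@CP_adj k n).
Proof. by move=> a; rewrite /CP_adj /= eqxx. Qed.

Definition CP (k : int) (n : nat) : sgraph :=
  SGraph (@CP_adj_sym k n) (@CP_adj_irrefl k n).

Definition phi (n : nat) : nat := (\prod_(p < n | prime p && odd p) p)%N.

(* Main.v *)
(** Since consecutive integers are coprime, k, ..., k+n-1 is a Hamiltonian path.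
    By strong induction on n we find a Hamiltonian cycle through the edges
    {k, k+1} and {k+n-2, k+n-1}.  Let p and q be the least odd primes not dividing
    k, resp. k+n-1; reflecting x to -x, assume p <= q.  A cycle of
    [k+p-1, k+n-1] through {k+p-1, k+p} extends to [k, k+n-1], because k and k+p
    are coprime.  The induction hypothesis gives this cycle unless
    - every odd prime below n-p+1 divides k+p-1.  If p >= 5, a prime factor r of
      p-2 divides k and k+n-1, hence n-1, so r < n-p+1 and r divides both p-1 and
      p-2, which is absurd.  If p = 3, then k is coprime to k+n-q, and one extends
      the cycle k+n-q-1, ..., k+n-1; or
    - every odd prime below n-p+1 divides k+n-1.  Then s = n-1-q < p; for s = 0 the
      path closes up, otherwise the offsets
      0, 1, p-1, ..., s+1, 2, ..., s, n-1, ..., p form a cycle, as every odd prime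
      below p divides k. *)
Require Import Defs.
From mathcomp Require Import all_boot all_order all_algebra.
From mathcomp Require Import zify.
Import Order.TTheory GRing.Theory Num.Theory.
Local Open Scope ring_scope.

Set Implicit Arguments.
Unset Strict Implicit.
Unset Printing Implicit Defensive.

(** * Coprimality of integers at a given distance *)

Definition cadj : rel int := [rel a b | (a != b) && (gcdz a b == 1)].

Lemma cadj_sym : symmetric cadj.
Proof. by move=> a b; rewrite /cadj /= eq_sym gcdzC. Qed.

Lemma cadjN a b : cadj (- a) (- b) = cadj a b.
Proof. by rewrite /cadj /= eqr_opp gcdzN gcdNz. Qed.

(** As [gcd(a, a + d) = gcd(a, d)], a common prime factor would divide both [d] and [a]. *)
Lemma cadj_dist (a b : int) (d : nat) : b = a + d%:Z -> (0 < d)%N ->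
  (forall r, prime r -> (r %| d)%N -> ~~ (r%:Z %| a)%Z) -> cadj a b.
Proof.
move=> -> d_gt0 dP; rewrite /cadj /= gcdzDl; apply/andP; split; first by lia.
apply: contraT => gcd_neq1.
have gcd_gt1 : (1 < gcdn `|a| d)%N.
  rewrite ltn_neqAle gcdn_gt0 d_gt0 orbT andbT eq_sym.
  by apply: contra gcd_neq1 => /eqP gcd1; rewrite /gcdz absz_nat gcd1.
have := dP _ (pdiv_prime gcd_gt1) (dvdn_trans (pdiv_dvd _) (dvdn_gcdr _ _)).
by rewrite dvdzE absz_nat (dvdn_trans (pdiv_dvd _) (dvdn_gcdl _ _)).
Qed.

Lemma cadj_succ a : cadj a (a + 1).
Proof. by apply: (@cadj_dist _ _ 1) => // r /prime_gt1; rewrite dvdn1; lia. Qed.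

(** * Ascending and descending runs of integers *)

Definition CP_down (k : int) (n : nat) : seq int := [seq k - i%:Z | i <- iota 0 n].

Lemma mem_CP_down k n x : (x \in CP_down k n) = (k - n%:Z < x <= k).
Proof.
apply/mapP/idP => [[i]|xP]; first by rewrite mem_iota => ? ->; lia.
by exists `|k - x|%N; rewrite ?mem_iota; lia.
Qed.

Lemma size_CP_vertices k n : size (CP_vertices k n) = n.
Proof. by rewrite size_map size_iota. Qed.

Lemma size_CP_down k n : size (CP_down k n) = n.
Proof. by rewrite size_map size_iota. Qed.

Lemma CP_vertices_uniq k n : uniq (CP_vertices k n).
Proof. by rewrite map_inj_uniq ?iota_uniq // => i j; lia. Qed.

Lemma CP_verticesS k n : CP_vertices k n.+1 = k :: CP_vertices (k + 1) n.
Proof.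
rewrite /CP_vertices /= addr0 (iotaDl 1 0) -map_comp; congr (_ :: _).
by apply: eq_map => i /=; lia.
Qed.

Lemma CP_downS k n : CP_down k n.+1 = k :: CP_down (k - 1) n.
Proof.
rewrite /CP_down /= subr0 (iotaDl 1 0) -map_comp; congr (_ :: _).
by apply: eq_map => i /=; lia.
Qed.

(** Tying [a] to [x] by an equation lets the rule apply to runs written as [k + 2] after [k + 1]. *)
Lemma path_CP_vertices x a n : a = x + 1 -> path cadj x (CP_vertices a n).
Proof.
move=> ->; elim: n x => // n IHn x.
by rewrite CP_verticesS /= cadj_succ IHn.
Qed.

Lemma last_CP_vertices x a n : a = x + 1 -> last x (CP_vertices a n) = x + n%:Z.
Proof.
move=> ->; elim: n x => [|n IHn] x; first by rewrite /=; lia.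
by rewrite CP_verticesS /= IHn; lia.
Qed.

Lemma path_CP_down x a n : a = x - 1 -> path cadj x (CP_down a n).
Proof.
move=> ->; elim: n x => // n IHn x.
by rewrite CP_downS /= IHn cadj_sym -{2}(subrK 1 x) cadj_succ.
Qed.

Lemma last_CP_down x a n : a = x - 1 -> last x (CP_down a n) = x - n%:Z.
Proof.
move=> ->; elim: n x => [|n IHn] x; first by rewrite /=; lia.
by rewrite CP_downS /= IHn; lia.
Qed.

(** * Cycles through both end edges, and their constructions *)

(* Covering the n vertices with length n forces c to be duplicate-free.  The edge
   {x, y} may be traversed in either direction, so that the notion is stable under
   the reflection, which exchanges it with {k, k+1}. *)
Definition end_edges_cycle (k : int) (n : nat) : Prop :=
  exists (a b : seq int) (x y : int), let c := k :: k + 1 :: a ++ x :: y :: b in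
  [/\ cycle cadj c, size c = n, c =i CP_vertices k n &
      (x = k + n%:Z - 2 /\ y = k + n%:Z - 1) \/
      (x = k + n%:Z - 1 /\ y = k + n%:Z - 2)].

Lemma cycle_cadj_rev c : cycle cadj (rev c) = cycle cadj c.
Proof. by rewrite rev_cycle; apply: eq_cycle => a b; rewrite cadj_sym. Qed.

Lemma end_edges_cycle_opp k n : (4 <= n)%N ->
  end_edges_cycle (- (k + n%:Z - 1)) n -> end_edges_cycle k n.
Proof.
move=> n_ge4 [a [b [x [y [c_cyc c_size c_mem xyP]]]]].
set oppz := [fun z : int => - z].
have cN_cyc := c_cyc; rewrite -(eq_cycle cadjN) -(@cycle_map _ _ oppz) in cN_cyc.
have memN s z : (z \in map oppz s) = (- z \in s).
  by rewrite -[z in LHS]opprK (mem_map (@oppr_inj _)).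
have c_sizeN := c_size; rewrite -(size_map oppz) in c_sizeN.
have cN_mem z : (z \in map oppz (- (k + n%:Z - 1) :: - (k + n%:Z - 1) + 1 ::
    a ++ x :: y :: b)) = (k <= z < k + n%:Z).
  by rewrite memN c_mem mem_CP_vertices; lia.
have k0E : - - (k + n%:Z - 1) = k + n%:Z - 1 by lia.
have k1E : - (- (k + n%:Z - 1) + 1) = k + n%:Z - 2 by lia.
move: cN_cyc c_sizeN cN_mem; rewrite /= map_cat /= k0E k1E.
move: (map oppz a) (map oppz b) => a' b'.
(* If the negated cycle runs from [k + 1] to [k], it is reversed; otherwise a rotation suffices. *)
case: xyP => -[-> ->].
- have -> : - (- (k + n%:Z - 1) + n%:Z - 2) = k + 1 by lia.
  have -> : - (- (k + n%:Z - 1) + n%:Z - 1) = k by lia.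
  move=> cN_cyc cN_size cN_mem.
  exists (rev a'), (rev b'), (k + n%:Z - 2), (k + n%:Z - 1); split; last by left.
  + rewrite -cycle_cadj_rev 2!rev_cons rev_cat !rev_cons !revK.
    by rewrite -!cats1 -!catA cycle_catC /= -!catA.
  + by move: cN_size; rewrite /= !size_cat /= !size_rev; lia.
  + move=> z; move: (cN_mem z); rewrite mem_CP_vertices => <-.
    by rewrite !(inE, mem_cat, mem_rev); lia.
- have -> : - (- (k + n%:Z - 1) + n%:Z - 2) = k + 1 by lia.
  have -> : - (- (k + n%:Z - 1) + n%:Z - 1) = k by lia.
  move=> cN_cyc cN_size cN_mem.
  exists b', a', (k + n%:Z - 1), (k + n%:Z - 2); split; last by right.
  + by rewrite -2!cat_cons cycle_catC.
  + by move: cN_size; rewrite /= !size_cat /=; lia.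
  + move=> z; move: (cN_mem z); rewrite mem_CP_vertices => <-.
    by rewrite !(inE, mem_cat); lia.
Qed.

(* The edge between k + u - 1 and k + u is replaced by the detour
   k + u - 1, ..., k + 1, k, k + u. *)
Lemma end_edges_cycle_extend k n u : (2 <= u)%N -> (u + 3 <= n)%N ->
  cadj k (k + u%:Z) -> end_edges_cycle (k + u%:Z - 1) (n - u).+1 ->
  end_edges_cycle k n.
Proof.
move=> u_ge2 u_le cadj_u [a [b [x [y [c_cyc c_size c_mem xyP]]]]].
(* The smaller cycle is followed backwards from [k + u - 1] to [k + u], hence [rev] and the exchange
   of [x] and [y]. *)
exists (CP_vertices (k + 2) (u - 2) ++ rev b), (rev a ++ [:: k + u%:Z]), y, x.
split; last by case: xyP => -[-> ->]; [right|left]; split; lia.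
- have : cycle cadj (k + u%:Z - 1 :: (rev b ++ y :: x :: rev a) ++ [:: k + u%:Z]).
    rewrite -cat1s cycle_catC -cycle_cadj_rev !(rev_cat, rev_cons, revK).
    rewrite subrK in c_cyc.
    by rewrite -!cats1 -!catA.
  rewrite /= cadj_succ -[X in rcons X k]catA [X in path _ (k + 1) X]rcons_cat.
  rewrite [X in _ && X]cat_path path_CP_vertices ?last_CP_vertices /=; try lia.
  have -> : k + 1 + (u - 2)%:Z = k + u%:Z - 1 by lia.
  rewrite !rcons_cat !cat_path /= !rcons_cat !cat_path /= (cadj_sym _ k).
  by rewrite last_cat cadj_u => /and3P[/and4P[-> -> -> ->] -> _].
- move: c_size; rewrite /= !(size_cat, size_rev, size_CP_vertices) /=.
  by rewrite size_cat size_rev /=; lia.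
- move=> z; move: (c_mem z); rewrite !(mem_CP_vertices, inE, mem_cat, mem_rev).
  by lia.
Qed.

Lemma end_edges_cycle_close k n : (4 <= n)%N -> cadj k (k + n%:Z - 1) ->
  end_edges_cycle k n.
Proof.
move=> n_ge4 k_last.
exists (CP_vertices (k + 2) (n - 4)), [::], (k + n%:Z - 2), (k + n%:Z - 1).
split; last by left.
- rewrite /= cadj_succ rcons_cat cat_path path_CP_vertices ?last_CP_vertices; try (by lia).
  rewrite /= (cadj_sym _ k) k_last.
  have -> : k + n%:Z - 2 = k + 1 + (n - 4)%:Z + 1 by lia.
  have -> : k + n%:Z - 1 = k + 1 + (n - 4)%:Z + 1 + 1 by lia.
  by rewrite !cadj_succ.
- by rewrite /= size_cat size_CP_vertices /=; lia.
- by move=> z; rewrite !(mem_CP_vertices, inE, mem_cat); lia.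
Qed.

(** The four adjacencies are the jumps between the runs [k, k+1]; [k+p-1] down to [k+s+1]; [k+2] up
    to [k+s]; [k+n-1] down to [k+p]. *)
Lemma end_edges_cycle_swap k n p s : (2 <= s)%N -> (s + 2 <= p)%N -> (p + 2 <= n)%N ->
  cadj k (k + p%:Z) -> cadj (k + 1) (k + p%:Z - 1) ->
  cadj (k + 2) (k + s%:Z + 1) -> cadj (k + s%:Z) (k + n%:Z - 1) ->
  end_edges_cycle k n.
Proof.
move=> s_ge2 s_le p_le adj0 adj1 adj2 adjs.
exists (k + p%:Z - 1 :: CP_down (k + p%:Z - 2) (p - s - 2) ++
        k + 2 :: CP_vertices (k + 3) (s - 2)),
  (CP_down (k + n%:Z - 3) (n - p - 2)), (k + n%:Z - 1), (k + n%:Z - 2).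
split; last by right.
- rewrite /= cadj_succ adj1 !rcons_cat !cat_path /= rcons_path.
  rewrite ?path_CP_down ?path_CP_vertices ?last_CP_down ?last_CP_vertices /=; try (by lia).
  rewrite last_cat /= ?last_CP_vertices; try (by lia).
  have -> : k + p%:Z - 1 - (p - s - 2)%:Z = k + s%:Z + 1 by lia.
  have -> : k + 2 + (s - 2)%:Z = k + s%:Z by lia.
  have -> : k + n%:Z - 2 - (n - p - 2)%:Z = k + p%:Z by lia.
  rewrite (cadj_sym _ (k + 2)) adj2 adjs (cadj_sym _ k) adj0 cadj_sym.
  have -> : k + n%:Z - 1 = k + n%:Z - 2 + 1 by lia.
  by rewrite cadj_succ.
- by rewrite /= !size_cat /= !size_CP_down size_CP_vertices; lia.
- by move=> z; rewrite !(mem_CP_vertices, mem_CP_down, inE, mem_cat); lia.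
Qed.

(** * Prime distances and the least odd prime not dividing an integer *)

Lemma dvdz_dist (r d : nat) (a b : int) : b = a + d%:Z ->
  (r%:Z %| a)%Z -> (r%:Z %| b)%Z -> (r %| d)%N.
Proof.
move=> bE ra rb; have : (r%:Z %| b - a)%Z by rewrite rpredB.
by rewrite bE addrC addKr dvdzE !absz_nat.
Qed.

Lemma cadj_prime (a b : int) (q : nat) : prime q -> b = a + q%:Z ->
  ~~ (q%:Z %| a)%Z -> cadj a b.
Proof.
move=> q_pr bE qa; apply: (cadj_dist bE (prime_gt0 q_pr)) => r r_pr.
by rewrite dvdn_prime2 // => /eqP ->.
Qed.

Lemma cadj_primeV (a b : int) (q : nat) : prime q -> b = a + q%:Z ->
  ~~ (q%:Z %| b)%Z -> cadj a b.
Proof.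
move=> q_pr bE; rewrite bE => qb; apply: (cadj_prime q_pr) => //.
by apply: contra qb => qa; rewrite rpredD // dvdzz.
Qed.

Lemma prime_dvd_phi n r : prime r -> odd r -> (r < n)%N -> (r %| phi n)%N.
Proof.
move=> r_pr r_odd r_lt.
by rewrite /phi (bigD1 (Ordinal r_lt)) /= ?r_pr ?r_odd ?dvdn_mulr.
Qed.

Lemma phi_dvd n k :
  (forall r, prime r -> odd r -> (r < n)%N -> (r%:Z %| k)%Z) ->
  ((phi n)%:Z %| k)%Z.
Proof.
rewrite dvdzE absz_nat /phi big_mkcond /= => rk.
(* Coprimality of the partial product to all later primes is carried along, so that each new prime
   factor can be multiplied in. *)
suff [] : (\prod_(i < n) (if prime i && odd i then i : nat else 1) %| `|k|)%N /\
  forall r, prime r -> (n <= r)%N ->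
    coprime r (\prod_(i < n) (if prime i && odd i then i : nat else 1)) by [].
elim: n rk => [|n IHn] rk; first by rewrite big_ord0; split=> // r; rewrite coprimen1.
have [|dvd_n cop_n] := IHn; first by move=> r ? ? ?; apply: rk => //; apply: ltnW.
rewrite big_ord_recr /=; split=> [|r r_pr r_ge].
  case: ifP => [/andP[n_pr n_odd]|_]; last by rewrite muln1.
  rewrite Gauss_dvd ?dvd_n /=; last by rewrite coprime_sym cop_n.
  by have := rk n n_pr n_odd (ltnSn n); rewrite dvdzE absz_nat.
rewrite coprimeMr cop_n ?(ltnW r_ge) //=; case: ifP => [/andP[n_pr _]|_]; last exact: coprimen1.
by rewrite prime_coprime // dvdn_prime2 //; lia.
Qed.

Lemma odd_dvdn (r d : nat) : odd d -> (r %| d)%N -> odd r.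
Proof. by move=> d_odd /dvdnP[e dE]; move: d_odd; rewrite dE oddM => /andP[]. Qed.

Definition least_odd_prime_ndvd (k : int) (p : nat) : Prop :=
  [/\ prime p, odd p, ~~ (p%:Z %| k)%Z &
      forall r, prime r -> odd r -> (r < p)%N -> (r%:Z %| k)%Z].

Lemma ex_least_odd_prime_ndvd n k : ~~ ((phi n)%:Z %| k)%Z ->
  exists2 p, least_odd_prime_ndvd k p & (p < n)%N.
Proof.
move=> phik.
pose P r := [&& prime r, odd r & ~~ (r%:Z %| k)%Z].
have [/existsP[r rP]|noP] := boolP [exists r : 'I_n, P r].
  have exP : exists r, P r by exists (r : nat).
  case: (ex_minnP exP) => p /and3P[p_pr p_odd pk] p_min.
  exists p; last by rewrite (leq_ltn_trans _ (ltn_ord r)) ?p_min.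
  split=> // t t_pr t_odd; apply: contraTT => tk.
  by rewrite -leqNgt p_min // /P t_pr t_odd.
case/negP: phik; apply: phi_dvd => r r_pr r_odd r_lt.
apply: contraNT noP => rk; apply/existsP; exists (Ordinal r_lt).
by rewrite /P /= r_pr r_odd.
Qed.

(** * The induction *)

Lemma end_edges_cycle_step n k p q : (4 <= n)%N -> ~~ odd n ->
  (forall m j, (m < n)%N -> (4 <= m)%N -> ~~ odd m ->
     ~~ ((phi m)%:Z %| j)%Z -> ~~ ((phi m)%:Z %| j + m%:Z - 1)%Z ->
     end_edges_cycle j m) ->
  least_odd_prime_ndvd k p -> least_odd_prime_ndvd (k + n%:Z - 1) q ->
  (p <= q < n)%N -> end_edges_cycle k n.
Proof.
move=> n_ge4 n_even IHn [p_pr p_odd pk p_min] [q_pr q_odd qk q_min] /andP[pq q_lt].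
have p_gt2 : (2 < p)%N by rewrite odd_prime_gt2.
have q_gt2 : (2 < q)%N by rewrite odd_prime_gt2.
have [qE|q_neq] := eqVneq q n.-1.
  by apply: end_edges_cycle_close => //; apply: (cadj_primeV q_pr) => //; lia.
(* Both [q] and [n - 1] are odd, so [q < n - 1] gives [q <= n - 3]. *)
have p_le : (p + 3 <= n)%N by lia.
have adj0 : cadj k (k + p%:Z) by apply: (cadj_prime p_pr).
have lastE : k + n%:Z - 1 = k + n.-1%:Z by lia.
have pE' : k + p%:Z - 1 = k + p.-1%:Z by lia.
have min_dvd (r d : nat) : prime r -> (r %| d)%N -> odd d ->
    (0 < d < p)%N -> (r%:Z %| k)%Z.
  move=> r_pr rd d_odd /andP[d_gt0 d_lt]; apply: p_min => //.
    exact: odd_dvdn rd.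
  exact: leq_ltn_trans (dvdn_leq d_gt0 rd) d_lt.
have [phi_first|phi_first] := boolP ((phi (n - p).+1)%:Z %| k + p%:Z - 1)%Z.
  have phi_r r : prime r -> odd r -> (r < (n - p).+1)%N -> (r%:Z %| k + p%:Z - 1)%Z.
    move=> r_pr r_odd r_lt; apply: dvdz_trans phi_first.
    by rewrite dvdzE !absz_nat prime_dvd_phi.
  have [pE|p_neq3] := eqVneq p 3.
    (* A prime dividing [k] and the odd number [n - q <= n - 3] also divides [k + 2] by [phi_r],
       hence divides 2. *)
    apply: (@end_edges_cycle_extend _ _ (n - q)); [lia|lia| |].
      apply: (@cadj_dist _ _ (n - q)) => //; first by lia.
      move=> r r_pr r_dvd; apply/negP => rk.
      have nq_odd : odd (n - q) by clear -n_even q_odd q_lt; lia.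
      have r_odd := odd_dvdn nq_odd r_dvd.
      have r_lt : (r < (n - p).+1)%N.
        have nq_gt0 : (0 < n - q)%N by rewrite subn_gt0.
        by have := dvdn_leq nq_gt0 r_dvd; clear -pE q_gt2 q_lt; lia.
      have : (r %| 2)%N.
        by apply: (dvdz_dist _ rk (phi_r r r_pr r_odd r_lt)); rewrite pE' pE.
      by rewrite dvdn_prime2 // => /eqP rE; rewrite rE in r_odd.
    (* The remaining interval has [q + 1] elements, so its ends differ by [q]. *)
    apply: end_edges_cycle_close; first by lia.
    apply: (cadj_primeV q_pr); first by lia.
    by apply: contra qk; congr dvdz; lia.
  exfalso.
  have p_gt3 : (1 < p - 2)%N by clear -p_gt2 p_neq3 p_odd; lia.
  have p2_odd : odd (p - 2) by clear -p_gt2 p_odd; lia.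
  have r_pr := pdiv_prime p_gt3; have r_dvd := pdiv_dvd (p - 2).
  move: (pdiv (p - 2)) r_pr r_dvd => r r_pr r_dvd.
  have r_odd := odd_dvdn p2_odd r_dvd.
  have r_lt : (r < p)%N.
    by have := dvdn_leq (ltnW p_gt3) r_dvd; clear -p_gt3; lia.
  have rk := p_min r r_pr r_odd r_lt.
  have r_n1 : (r %| n.-1)%N.
    exact: dvdz_dist lastE rk (q_min r r_pr r_odd (leq_trans r_lt pq)).
  (* [r] divides the even number [(n - 1) - (p - 2)], so it is smaller. *)
  have r_lt' : (r < (n - p).+1)%N.
    have n'E : (n - p).+1 = (n.-1 - (p - 2))%N by clear -p_gt2 p_le; lia.
    have : (r <= (n - p).+1)%N by rewrite n'E dvdn_leq -?n'E // n'E dvdn_sub.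
    by clear -r_odd p_odd n_even p_le; lia.
  have r_p1 : (r %| p.-1)%N.
    exact: dvdz_dist pE' rk (phi_r r r_pr r_odd r_lt').
  have : (r %| p.-1 - (p - 2))%N by rewrite dvdn_sub.
  have -> : (p.-1 - (p - 2) = 1)%N by clear -p_gt2; lia.
  by rewrite dvdn1 => /eqP r1; rewrite r1 in r_pr.
have [phi_last|phi_last] := boolP ((phi (n - p).+1)%:Z %| k + n%:Z - 1)%Z.
  have q_ge : ((n - p).+1 <= q)%N.
    rewrite leqNgt; apply: contra qk => q_lt'; apply: dvdz_trans phi_last.
    by rewrite dvdzE !absz_nat prime_dvd_phi.
  (* The bound [q >= n - p + 1] gives [s <= p - 2]; parity and [q <> n - 1] give [s >= 2]. *)
  have sE : exists s : nat, [/\ n.-1 = (s + q)%N, (2 <= s)%N, ~~ odd s & (s + 2 <= p)%N].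
    by exists (n.-1 - q)%N; clear -n_even q_odd q_neq q_lt q_ge p_le p_odd; split; lia.
  have [s [nE s_ge2 s_even s_le]] := sE.
  have p2_odd : odd (p - 2) by clear -p_gt2 p_odd; lia.
  have s1_odd : odd (s - 1) by clear -s_ge2 s_even; lia.
  (* The jumps from [k + 1] and [k + 2] have odd lengths [p - 2] and [s - 1] below [p], whose prime
     factors divide [k]; the jump from [k + s] has length [q]. *)
  apply: (end_edges_cycle_swap s_ge2 s_le) => //; first by clear -p_le; lia.
  - apply: (@cadj_dist _ _ (p - 2)); [clear -p_gt2; lia|clear -p_gt2; lia|].
    move=> r r_pr r_dvd; apply/negP => rk1.
    have rk : (r%:Z %| k)%Z by apply: min_dvd r_dvd _ _ => //; clear -p_gt2; lia.
    have : (r %| 1)%N by apply: dvdz_dist rk rk1.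
    by rewrite dvdn1 => /eqP r1; rewrite r1 in r_pr.
  - apply: (@cadj_dist _ _ (s - 1)); [clear -s_ge2; lia|clear -s_ge2; lia|].
    move=> r r_pr r_dvd; apply/negP => rk2.
    have r_odd := odd_dvdn s1_odd r_dvd.
    have rk : (r%:Z %| k)%Z by apply: min_dvd r_dvd _ _ => //; clear -s_ge2 s_le; lia.
    have : (r %| 2)%N by apply: dvdz_dist rk rk2.
    by rewrite dvdn_prime2 // => /eqP rE; rewrite rE in r_odd.
  - by apply: (cadj_primeV q_pr) => //; clear -nE s_ge2; lia.
(* Neither end is obstructed, and [n - p + 1] is even and at least 4. *)
apply: (@end_edges_cycle_extend _ _ p) => //; first by lia.
apply: IHn => //; [| | |by apply: contra phi_last; congr dvdz; lia].
- by clear -p_gt2 p_le; lia.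
- by clear -p_gt2 p_le; lia.
- by clear -n_even p_odd p_le; lia.
Qed.

Lemma ex_end_edges_cycle n k : (4 <= n)%N -> ~~ odd n ->
  ~~ ((phi n)%:Z %| k)%Z -> ~~ ((phi n)%:Z %| k + n%:Z - 1)%Z ->
  end_edges_cycle k n.
Proof.
have [m] := ubnP n; elim: m n k => // m IHm n k n_lt n_ge4 n_even phi1 phi2.
have IHn m' j : (m' < n)%N -> (4 <= m')%N -> ~~ odd m' ->
    ~~ ((phi m')%:Z %| j)%Z -> ~~ ((phi m')%:Z %| j + m'%:Z - 1)%Z ->
    end_edges_cycle j m'.
  by move=> m'_lt; apply: IHm; lia.
have [p pP p_lt] := ex_least_odd_prime_ndvd phi1.
have [q qP q_lt] := ex_least_odd_prime_ndvd phi2.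
have [pq|qp] := leqP p q; first by apply: end_edges_cycle_step pP qP _; rewrite ?pq.
have least_opp j r : least_odd_prime_ndvd j r -> least_odd_prime_ndvd (- j) r.
  by case=> r_pr r_odd rj r_min; split=> // [|t *]; rewrite rpredN //; apply: r_min.
(* Reflection interchanges the roles of [p] and [q]. *)
apply: end_edges_cycle_opp => //.
have pP' : least_odd_prime_ndvd (- (k + n%:Z - 1) + n%:Z - 1) p.
  by have -> : - (k + n%:Z - 1) + n%:Z - 1 = - k; [lia|apply: least_opp].
by apply: end_edges_cycle_step (least_opp _ _ qP) pP' _; rewrite // p_lt ltnW.
Qed.

(** * From a cycle of integers to a cycle of the graph *)

Theorem theorem2p9 (n : nat) (k : int) (n_ge4 : (4 <= n)%N) (n_even : ~~ odd n)
    (phi_ndvd_first : ~~ ((phi n)%:Z %| k)%Z)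
    (phi_ndvd_last : ~~ ((phi n)%:Z %| k + n%:Z - 1)%Z) :
  hamiltonian (CP k n).
Proof.
have [a [b [x [y []]]]] := ex_end_edges_cycle n_ge4 n_even phi_ndvd_first phi_ndvd_last.
move: (_ :: _) => c c_cyc c_size c_mem _.
have c_uniq : uniq c.
  by rewrite (uniq_size_uniq (CP_vertices_uniq k n)) ?size_CP_vertices ?c_size.
(* No entry is lost in [pmap insub], since every entry of [c] is a vertex. *)
pose c' : seq (CP k n) := pmap insub c.
have valc' : map val c' = c.
  rewrite pmap_filter; last exact: insubK.
  by apply/all_filterP/allP => z zc; rewrite isSome_insub -c_mem.
exists c'; split.
- by rewrite -(size_map val) valc' c_size; lia.
- apply/andP; split; last by rewrite pmap_sub_uniq.
  rewrite -valc' cycle_map in c_cyc.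
  by rewrite (eq_cycle (e' := relpre val cadj)) // => u v.
- by move=> z; rewrite mem_pmap_sub c_mem; apply: valP.
Qed.
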